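(* Let $n\geq 4$ be an integer and let $K_n$ be the complete graph on $n$ vertices. The minimum coprime number of $K_n$ is $\mathfrak{pr}(K_n)=p_{n-1}$.
   Context: $p_i$ denotes the $i$-th prime number ($p_1=2$). All graphs are finite and simple. A coprime labeling of a graph $G$ with $n$ vertices is an assignment of distinct labels from $\{1,\ldots,m\}$, for some integer $m\ge n$, to the vertices of $G$ such that adjacent vertices receive relatively prime labels. The minimum coprime number $\mathfrak{pr}(G)$ is the minimum value $m$ for which such a labeling exists. *)

(* Defs.v *)
From mathcomp Require Import all_boot.

Set Implicit Arguments.
Unset Strict Implicit.
Unset Printing Implicit Defensive.

Lemma ex_next_prime (m : nat) : exists p, (m < p) && prime p.
Proof. by have [p lt_mp pr_p] := prime_above m; exists p; rewrite lt_mp. Qed.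

Definition next_prime (m : nat) : nat := ex_minn (ex_next_prime m).

(* One-based: nth_prime 1 = 2; the value nth_prime 0 = 0 is junk. *)
Definition nth_prime (i : nat) : nat := iter i next_prime 0.

Lemma next_primeP (m : nat) : (m < next_prime m) && prime (next_prime m).
Proof. by rewrite /next_prime; case: ex_minnP. Qed.

Lemma nth_prime_prime (i : nat) : prime (nth_prime i.+1).
Proof. by have /andP[] := next_primeP (nth_prime i). Qed.

Lemma nth_prime_lt : {homo nth_prime : i j / i < j}.
Proof.
by apply: homo_ltn; [exact: ltn_trans | move=> i; have /andP[] := next_primeP (nth_prime i)].
Qed.

Lemma nth_prime_inj : injective nth_prime.
Proof.
move=> i j eq_ij; case: (ltngtP i j) => // /nth_prime_lt;
  by rewrite eq_ij ltnn.
Qed.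

Record sgraph := SGraph {
  vertex :> finType;
  adj : rel vertex;
  adj_sym : symmetric adj;
  adj_irrefl : irreflexive adj }.

Lemma neq_sym (T : eqType) : symmetric (fun x y : T => x != y).
Proof. by move=> x y; rewrite eq_sym. Qed.

Lemma neq_irrefl (T : eqType) : irreflexive (fun x y : T => x != y).
Proof. by move=> x; rewrite eqxx. Qed.

Definition complete_graph (n : nat) : sgraph :=
  SGraph (@neq_sym 'I_n) (@neq_irrefl 'I_n).

(* Labels live in 'I_m.+1 = {0, ..., m}; the positivity condition restricts
   them to {1, ..., m}. *)
Definition coprime_labeling (G : sgraph) (m : nat) (f : {ffun G -> 'I_m.+1}) :=
  [&& injectiveb f,
      [forall v : G, 0 < f v] &
      [forall u : G, forall v : G, adj u v ==> coprime (f u) (f v)]].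

Definition has_coprime_labeling (G : sgraph) (m : nat) : bool :=
  (#|G| <= m) && [exists f : {ffun G -> 'I_m.+1}, coprime_labeling f].

(* Labeling the vertices with distinct primes always works. *)
Lemma ex_coprime_labeling (G : sgraph) : exists m, has_coprime_labeling G m.
Proof.
pose p (v : G) := nth_prime (enum_rank v).+1.
have p_prime v : prime (p v) by exact: nth_prime_prime.
have p_inj : injective p.
  by move=> u v /nth_prime_inj [] /ord_inj /enum_rank_inj.
pose m := maxn #|G| (\max_(v : G) p v).
have lt_pm v : p v < m.+1 by rewrite ltnS leq_max leq_bigmax orbT.
exists m; rewrite /has_coprime_labeling leq_maxl /=.
apply/existsP; exists [ffun v => Ordinal (lt_pm v)]; apply/and3P; split.
- by apply/injectiveP => u v; rewrite !ffunE => -[] /p_inj.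
- by apply/forallP => v; rewrite ffunE /= prime_gt0.
apply/forallP => u; apply/forallP => v; apply/implyP => adj_uv.
rewrite !ffunE /= prime_coprime // dvdn_prime2 //.
by apply: contraTneq adj_uv => /p_inj ->; rewrite adj_irrefl.
Qed.

Definition min_coprime_number (G : sgraph) : nat :=
  ex_minn (ex_coprime_labeling G).

(* Main.v *)
Require Import Defs.
From mathcomp Require Import all_boot.

(** Distinct pairwise coprime positive integers have distinct least prime
    factors, with the convention that the least prime factor of [1] is [1].
    So [n] such integers bounded by [m] yield [n] distinct elements of the set
    consisting of [1] and the primes up to [m] ([pdiv_coprime_labeling_inj]);
    this set has at most [n - 1] elements when [m] is less than the [n - 1]st
    prime ([mem_noncomposites]).  Conversely, [1] together with the first
    [n - 1] primes is a family of [n] pairwise coprime numbers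
    ([complete_graph_labeling]). *)

Set Implicit Arguments.
Unset Strict Implicit.
Unset Printing Implicit Defensive.

Lemma next_prime_min m q : prime q -> m < q -> next_prime m <= q.
Proof.
by move=> pr_q lt_mq; rewrite /next_prime; case: ex_minnP => p _; apply; rewrite lt_mq.
Qed.

Definition noncomposite (i : nat) : nat := if i is 0 then 1 else nth_prime i.

Lemma noncomposite_lt : {homo noncomposite : i j / i < j}.
Proof.
move=> [|i] [|j] //= lt_ij; last exact: (@nth_prime_lt i.+1 j.+1).
exact/prime_gt1/nth_prime_prime.
Qed.

Lemma noncomposite_inj : injective noncomposite.
Proof.
by move=> i j eq_ij; case: (ltngtP i j) => // /noncomposite_lt; rewrite eq_ij ltnn.
Qed.

Lemma noncomposite_gt i : i < noncomposite i.
Proof.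
by elim: i => // i IHi; apply: leq_ltn_trans IHi (noncomposite_lt (ltnSn i)).
Qed.

Lemma coprime_noncomposite i j :
  i != j -> coprime (noncomposite i) (noncomposite j).
Proof.
case: i j => [|i] [|j] //= neq_ij; rewrite ?coprime1n ?coprimen1 //.
rewrite prime_coprime ?dvdn_prime2 ?nth_prime_prime //.
by apply: contra neq_ij => /eqP/(@nth_prime_inj i.+1 j.+1)->.
Qed.

(** The enumeration of [1] and the primes has no gaps, because each prime is
    defined as the least one above its predecessor. *)
Lemma mem_noncomposites k q : (q == 1) || prime q -> q < noncomposite k.+1 ->
  q \in [seq noncomposite i | i <- iota 0 k.+1].
Proof.
case/orP=> [/eqP-> _|pr_q]; first by rewrite inE eqxx.
elim: k => [|k IHk] lt_q.
  have := next_prime_min pr_q (prime_gt0 pr_q).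
  by rewrite leqNgt lt_q.
rewrite -(addn1 k.+1) iotaD map_cat mem_cat mem_seq1 add0n.
have le_q : q <= noncomposite k.+1.
  by rewrite leqNgt; apply: contraL lt_q => lt_kq; rewrite -leqNgt next_prime_min.
by move: le_q; rewrite leq_eqVlt => /orP[->|/IHk ->]; rewrite ?orbT.
Qed.

Lemma pdiv_eq1_or_prime m : 0 < m -> (pdiv m == 1) || prime (pdiv m).
Proof. by case: m => [|[|m]] // _; rewrite (@pdiv_prime m.+2) ?orbT. Qed.

(** A common least prime factor of two coprime numbers would divide their gcd,
    so it can only be [1], and both numbers are then [1]. *)
Lemma coprime_pdiv_inj a b :
  0 < a -> 0 < b -> coprime a b -> pdiv a = pdiv b -> a = b.
Proof.
move=> a_gt0 b_gt0 co_ab eq_pdiv.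
have pdiv_a : pdiv a = 1.
  by apply/eqP; rewrite -dvdn1 -(eqP co_ab) dvdn_gcd pdiv_dvd eq_pdiv pdiv_dvd.
have eq1 c : 0 < c -> pdiv c = 1 -> c = 1.
  by case: c => [|[|c]] // _ /(congr1 prime); rewrite pdiv_prime.
by rewrite (eq1 a) // (eq1 b) // -eq_pdiv.
Qed.

Lemma pdiv_coprime_labeling_inj n m (f : {ffun complete_graph n -> 'I_m.+1}) :
  coprime_labeling f -> injective (fun v => pdiv (f v)).
Proof.
case/and3P=> /injectiveP f_inj /forallP f_gt0 /forallP f_co u v eq_uv.
apply/eqP/negPn/negP => neq_uv.
have /forallP /(_ v) /implyP /(_ neq_uv) co_uv := f_co u.
case/eqP: neq_uv; apply/f_inj/val_inj.
exact: coprime_pdiv_inj (f_gt0 u) (f_gt0 v) co_uv eq_uv.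
Qed.

Lemma complete_graph_labeling k :
  has_coprime_labeling (complete_graph k.+2) (nth_prime k.+1).
Proof.
apply/andP; split; first by rewrite card_ord (noncomposite_gt k.+1).
have lt_label (i : 'I_k.+2) : noncomposite i < (nth_prime k.+1).+1.
  rewrite ltnS -[nth_prime _]/(noncomposite k.+1).
  have := ltn_ord i; rewrite ltnS leq_eqVlt => /orP[/eqP -> //|].
  by move/noncomposite_lt/ltnW.
apply/existsP; exists [ffun i => Ordinal (lt_label i)]; apply/and3P; split.
- by apply/injectiveP => i j; rewrite !ffunE => -[] /noncomposite_inj /val_inj.
- by apply/forallP => i; rewrite ffunE /= (leq_ltn_trans _ (noncomposite_gt i)).
apply/forallP => i; apply/forallP => j; apply/implyP => neq_ij.
by rewrite !ffunE /= coprime_noncomposite.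
Qed.

Lemma complete_graph_labeling_lb k m :
  has_coprime_labeling (complete_graph k.+2) m -> nth_prime k.+1 <= m.
Proof.
case/andP=> _ /existsP[f f_lab]; rewrite leqNgt; apply/negP => lt_m.
have /and3P[_ /forallP f_gt0 _] := f_lab.
pose s := [seq pdiv (f v) | v <- enum 'I_k.+2].
have s_uniq : uniq s.
  by rewrite (map_inj_uniq (pdiv_coprime_labeling_inj f_lab)) enum_uniq.
have s_sub : {subset s <= [seq noncomposite i | i <- iota 0 k.+1]}.
  move=> _ /mapP[v _ ->]; apply: mem_noncomposites.
    exact: pdiv_eq1_or_prime (f_gt0 v).
  apply: leq_ltn_trans lt_m; apply: leq_trans (dvdn_leq (f_gt0 v) (pdiv_dvd _)) _.
  by rewrite -ltnS ltn_ord.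
have := uniq_leq_size s_uniq s_sub.
by rewrite /s size_map size_enum_ord size_map size_iota ltnn.
Qed.

Theorem proposition1 (n : nat) (hn : 4 <= n) :
  min_coprime_number (complete_graph n) = nth_prime (n - 1).
Proof.
case: n hn => [|[|k]] // _; rewrite subn1 /=.
rewrite /min_coprime_number; case: ex_minnP => m m_lab m_min.
by apply/eqP; rewrite eqn_leq m_min ?complete_graph_labeling // complete_graph_labeling_lb.
Qed.
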